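(* Let $(x_n)_{n\in\mathbb{Z}}$ be the sequence of rational functions in two indeterminates $x_1,x_2$ determined by $x_n x_{n-2}=x_{n-1}^2+1$ for all $n\in\mathbb{Z}$ (the case $(b,c)=(2,2)$). Then for every integer $n\neq 1,2$, $$x_n(x_1,x_2)=\frac{p_n(x_1,x_2)}{m_n(x_1,x_2)},$$ where $p_n$ is the sum of the weights of all perfect matchings of the weighted graph $G_n$, and $m_n$ is the monomial attached to $G_n$, both as defined in the context.
   Context: For $m\ge 1$, $H_m$ is the edge-weighted $2\times m$ grid graph (2 rows, $m$ columns of vertices): every vertical edge has weight $1$; for $1\le j\le m-1$ the two horizontal edges joining column $j$ to column $j+1$ both have weight $x_2$ if $j$ is odd and $x_1$ if $j$ is even. A perfect matching of a graph is a set $S$ of edges such that each vertex belongs to exactly one edge of $S$; its weight is the product of the weights of its edges. For $n\ge 3$: $G_n=H_{2n-4}$, $p_n(x_1,x_2)$ is the sum of the weights of all perfect matchings of $G_n$, and $m_n(x_1,x_2)=x_1^{n-2}x_2^{n-3}$. (Equivalently $m_n=x_1^ix_2^j$, where $i$ is the number of square cells of $G_n$ whose horizontal edges have weight $x_2$ and $j$ the number of those whose horizontal edges have weight $x_1$.) For $n\le 0$: $G_n$ is the graph $G_{3-n}$ with the weights $x_1$ and $x_2$ interchanged, $p_n$ is the sum of the weights of all perfect matchings of $G_n$ (so $p_n(x_1,x_2)=p_{3-n}(x_2,x_1)$), and $m_n(x_1,x_2)=m_{3-n}(x_2,x_1)=x_1^{-n}x_2^{1-n}$. *)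

(* Defs.v *)
From HB Require Import structures.
From mathcomp Require Import all_boot all_order all_algebra.
From mathcomp Require Import zify ring.
From mathcomp Require Export mpoly.

Set Implicit Arguments.
Unset Strict Implicit.
Unset Printing Implicit Defensive.

Import Order.TTheory GRing.Theory Num.Theory.
Local Open Scope ring_scope.

(* Edges form a type of their own, with [ends e] the set of endpoints of [e]. *)
Record wgraph (R : Type) := WGraph {
  vertex : finType;
  edge : finType;
  ends : edge -> {set vertex};
  weight : edge -> R
}.

Definition perfect_matching (R : Type) (G : wgraph R) (S : {set edge G}) : bool :=
  [forall v : vertex G, #|[set e in S | v \in ends e]| == 1%N].

Definition matching_sum (R : comNzRingType) (G : wgraph R) : R :=
  \sum_(S : {set edge G} | perfect_matching S) \prod_(e in S) weight e.

(* The 2 x m grid.  Rows and columns are numbered from 0, so that the columns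
   j and j + 1 here are the columns j + 1 and j + 2 of the numbering from 1.
   [inl j] is the vertical edge in column j, and [inr (i, j)] the horizontal
   edge in row i from column j to column j + 1. *)
Definition grid_edge (m : nat) : Type := ('I_m + 'I_2 * 'I_m.-1)%type.

Definition grid_ends (m : nat) (e : grid_edge m) : {set 'I_2 * 'I_m} :=
  match e with
  | inl j => [set v : 'I_2 * 'I_m | v.2 == j]
  | inr (i, j) =>
      [set v : 'I_2 * 'I_m | (v.1 == i) && ((v.2 == j :> nat) || (v.2 == j.+1 :> nat))]
  end.

(* With columns numbered from 1, the weight is b if the left column is odd and
   a if it is even; hence the parity is that of [j.+1]. *)
Definition grid_weight (R : comNzRingType) (a b : R) (m : nat)
    (e : grid_edge m) : R :=
  match e with
  | inl _ => 1
  | inr (_, j) => if odd j.+1 then b else a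
  end.

Definition grid (R : comNzRingType) (a b : R) (m : nat) : wgraph R :=
  @WGraph R ('I_2 * 'I_m)%type ('I_m + 'I_2 * 'I_m.-1)%type
    (@grid_ends m) (@grid_weight R a b m).

Notation poly2 := {mpoly rat[2]}.
Notation ratfun2 := {fraction {mpoly rat[2]}}.
Notation to_ratfun := (@FracField.tofrac {mpoly rat[2]}).

Definition X1 : poly2 := 'X_(ord0 : 'I_2).
Definition X2 : poly2 := 'X_(ord_max : 'I_2).

(* [G_], [p_] and [m_] are meaningful only for n <> 1, 2.  The second branch is
   the graph of index 3 - n, with the two indeterminates interchanged. *)
Definition G_ (n : int) : wgraph poly2 :=
  if 3 <= n then grid X1 X2 (absz (2 * n - 4)%R)
  else grid X2 X1 (absz (2 * (3 - n) - 4)%R).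

Definition p_ (n : int) : poly2 := matching_sum (G_ n).

Definition m_ (n : int) : poly2 :=
  if 3 <= n then X1 ^+ absz (n - 2)%R * X2 ^+ absz (n - 3)%R
  else X1 ^+ absz (- n)%R * X2 ^+ absz (1 - n)%R.

Definition is_cluster_seq (x : int -> ratfun2) : Prop :=
  [/\ x 1 = to_ratfun X1,
      x 2 = to_ratfun X2
    & forall n : int, x n * x (n - 2) = x (n - 1) ^+ 2 + 1].

(* The recurrence together with its two initial terms determines exactly one
   sequence: no term vanishes, since each is a quotient of two polynomials that
   are positive at (1, 1). *)
Definition pos_at_1 (f : ratfun2) : Prop :=
  exists q r : poly2, [/\ f = to_ratfun q / to_ratfun r,
    0 < meval (fun=> 1) q & 0 < meval (fun=> 1) r].

Definition forward (K : fieldType) (a b : K) (k : nat) : K :=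
  (iter k (fun u => (u.2, (u.2 ^+ 2 + 1) / u.1)) (a, b)).1.

Fact forward_rec (K : fieldType) (P : K -> Prop) (a b : K) (k : nat) :
    (forall u, P u -> u != 0) ->
    (forall u v, P u -> P v -> P ((v ^+ 2 + 1) / u)) -> P a -> P b ->
  forward a b k.+2 * forward a b k = forward a b k.+1 ^+ 2 + 1.
Proof.
move=> Pn0 Pnext Pa Pb; rewrite /forward /=.
set u := iter k _ _.
have [u1 u2] : P u.1 /\ P u.2.
  rewrite {}/u; elim: k => [|k [IH1 IH2]] //=.
  by split=> //; apply: Pnext.
by rewrite divfK // Pn0.
Qed.

Fact rec_seq_exists (K : fieldType) (P : K -> Prop) (a b : K) :
    (forall u, P u -> u != 0) ->
    (forall u v, P u -> P v -> P ((v ^+ 2 + 1) / u)) -> P a -> P b ->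
  exists x : int -> K, [/\ x 1 = a, x 2 = b
    & forall n : int, x n * x (n - 2) = x (n - 1) ^+ 2 + 1].
Proof.
move=> Pn0 Pnext Pa Pb.
pose x (n : int) := if 1 <= n then forward a b (absz (n - 1)%R)
                    else forward b a (absz (2 - n)%R).
have xge (n : int) : 1 <= n -> x n = forward a b (absz (n - 1)%R).
  by rewrite /x => ->.
have xle (n : int) : n <= 2 -> x n = forward b a (absz (2 - n)%R).
  move=> n2; rewrite /x; case: ifP => // n1.
  by have [->|->] : n = 1 \/ n = 2 by lia.
exists x; split=> // n.
have [n3|n2] := leP 3 n.
  rewrite !xge; try lia.
  have -> : absz (n - 1)%R = (absz (n - 2 - 1)%R).+2 by lia.
  have -> : absz (n - 1 - 1)%R = (absz (n - 2 - 1)%R).+1 by lia.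
  exact: (forward_rec (P := P)).
rewrite !xle; try lia.
have -> : absz (2 - (n - 2))%R = (absz (2 - n)%R).+2 by lia.
have -> : absz (2 - (n - 1))%R = (absz (2 - n)%R).+1 by lia.
by rewrite mulrC; exact: (forward_rec (P := P)).
Qed.

Fact rec_seq_unique (K : fieldType) (P : K -> Prop) (a b : K) (x y : int -> K) :
    (forall u, P u -> u != 0) ->
    (forall u v, P u -> P v -> P ((v ^+ 2 + 1) / u)) -> P a -> P b ->
    x 1 = a -> x 2 = b ->
    (forall n : int, x n * x (n - 2) = x (n - 1) ^+ 2 + 1) ->
    y 1 = a -> y 2 = b ->
    (forall n : int, y n * y (n - 2) = y (n - 1) ^+ 2 + 1) ->
  x =1 y.
Proof.
move=> Pn0 Pnext Pa Pb x_1 x_2 xr y_1 y_2 yr.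
have up (k : nat) : [/\ x (k%:Z + 1) = y (k%:Z + 1), x (k%:Z + 2) = y (k%:Z + 2),
    P (x (k%:Z + 1)) & P (x (k%:Z + 2))].
  elim: k => [|k [e1 e2 q1 q2]]; first by rewrite !add0r x_1 x_2 y_1 y_2.
  have -> : k.+1%:Z + 1 = k%:Z + 2 by lia.
  have -> : k.+1%:Z + 2 = k%:Z + 3 by lia.
  have xE := xr (k%:Z + 3); have yE := yr (k%:Z + 3).
  have E2 : k%:Z + 3 - 2 = k%:Z + 1 by lia.
  have E1 : k%:Z + 3 - 1 = k%:Z + 2 by lia.
  rewrite E1 E2 in xE yE.
  have nz := Pn0 _ q1.
  have xk : x (k%:Z + 3) = (x (k%:Z + 2) ^+ 2 + 1) / x (k%:Z + 1).
    by rewrite -xE mulfK.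
  split=> //; last by rewrite xk; apply: Pnext.
  by apply: (mulIf nz); rewrite xE e1 yE e2.
have down (k : nat) : [/\ x (2 - k%:Z) = y (2 - k%:Z), x (1 - k%:Z) = y (1 - k%:Z),
    P (x (2 - k%:Z)) & P (x (1 - k%:Z))].
  elim: k => [|k [e1 e2 q1 q2]]; first by rewrite !subr0 x_1 x_2 y_1 y_2.
  have -> : 2 - k.+1%:Z = 1 - k%:Z by lia.
  have -> : 1 - k.+1%:Z = 0 - k%:Z by lia.
  have xE := xr (2 - k%:Z); have yE := yr (2 - k%:Z).
  have E2 : 2 - k%:Z - 2 = 0 - k%:Z by lia.
  have E1 : 2 - k%:Z - 1 = 1 - k%:Z by lia.
  rewrite E1 E2 in xE yE.
  have nz := Pn0 _ q1.
  have xk : x (0 - k%:Z) = (x (1 - k%:Z) ^+ 2 + 1) / x (2 - k%:Z).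
    by rewrite -xE mulrC mulKf.
  split=> //; last by rewrite xk; apply: Pnext.
  by apply: (mulfI nz); rewrite xE e1 yE e2.
move=> n; have [n1|n1] := leP 1 n.
  have [e _ _ _] := up (absz (n - 1)%R).
  by have <- : (absz (n - 1)%R)%:Z + 1 = n by lia.
have [e _ _ _] := down (absz (2 - n)%R).
by have <- : 2 - (absz (2 - n)%R)%:Z = n by lia.
Qed.

Fact meval_neq0 (q : poly2) : 0 < meval (fun=> 1) q -> to_ratfun q != 0.
Proof.
move=> q0; rewrite tofrac_eq0; apply: contraTneq q0 => ->.
by rewrite meval0 ltxx.
Qed.

Fact pos_at_1_neq0 (f : ratfun2) : pos_at_1 f -> f != 0.
Proof.
by case=> q [r [-> q0 r0]]; rewrite mulf_neq0 ?invr_eq0 ?meval_neq0.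
Qed.

Fact quotient_next (K : fieldType) (q r s t : K) : q != 0 -> r != 0 -> t != 0 ->
  ((s / t) ^+ 2 + 1) / (q / r) = ((s * s + t * t) * r) / (t * t * q).
Proof. by move=> q0 r0 t0; field; rewrite q0 t0 r0. Qed.

Fact pos_at_1_next (a b : ratfun2) :
  pos_at_1 a -> pos_at_1 b -> pos_at_1 ((b ^+ 2 + 1) / a).
Proof.
move=> [q [r [-> q0 r0]]] [s [t [-> s0 t0]]].
exists ((s * s + t * t) * r), (t * t * q); split.
- by rewrite quotient_next ?meval_neq0 // -!tofracM -tofracD -tofracM.
- by rewrite mevalM mevalD !mevalM mulr_gt0 ?addr_gt0 ?mulr_gt0.
- by rewrite !mevalM !mulr_gt0.
Qed.

Fact pos_at_1_X (i : 'I_2) : pos_at_1 (to_ratfun 'X_i).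
Proof. by exists 'X_i, 1; rewrite tofrac1 divr1 mevalXU meval1 ltr01. Qed.

Lemma cluster_seq_exists : exists x, is_cluster_seq x.
Proof.
exact: (rec_seq_exists pos_at_1_neq0 pos_at_1_next (pos_at_1_X _) (pos_at_1_X _)).
Qed.

Lemma cluster_seq_unique (x y : int -> ratfun2) :
  is_cluster_seq x -> is_cluster_seq y -> x =1 y.
Proof.
move=> [x_1 x_2 xr] [y_1 y_2 yr].
exact: (rec_seq_unique pos_at_1_neq0 pos_at_1_next (pos_at_1_X _) (pos_at_1_X _)
          x_1 x_2 xr y_1 y_2 yr).
Qed.

(* Main.v *)
Require Import Defs.
From mathcomp Require Import all_boot all_order all_algebra.
From mathcomp Require Import zify ring.
Import GRing.Theory Num.Theory.
Local Open Scope ring_scope.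

Set Implicit Arguments.
Unset Strict Implicit.

(** Matching the last column of a [2 x m] grid either by its vertical edge or
    by the two horizontal edges to its left gives a two-term recurrence for the
    matching sums.  The sums [E_k] for [m = 2k] then satisfy
    the constant-coefficient recurrence
    [E_(k+2) = (1 + a^2 + b^2) E_(k+1) - a^2 b^2 E_k],
    so that [E_(k+2) E_k - E_(k+1)^2] is multiplied by [a^2 b^2] when [k] grows
    by one, hence equals [a^(2k+2) b^(2k)].  Divided by the monomials, this is
    the relation between three consecutive terms of the cluster sequence;
    indices [n <= 0] follow by reversing the sequence, which interchanges the
    indeterminates. *)

(** * Expansion of matching sums at a vertex *)

Section InducedMatchings.
Variables (R : comNzRingType) (G : wgraph R).
Implicit Types (v : vertex G) (W : {set vertex G}) (S : {set edge G}).

(* The perfect matchings of the subgraph induced by [W], kept as edge sets of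
   [G] so that removing vertices does not change the type of edges. *)
Definition induced_matching W S : bool :=
  [forall v, (\sum_(e in S) (v \in ends e))%N == (v \in W)].

Definition induced_sum W : R :=
  \sum_(S : {set edge G} | induced_matching W S) \prod_(e in S) weight e.

Lemma matching_sumE : matching_sum G = induced_sum setT.
Proof.
apply: eq_bigl => S; apply: eq_forallb => v.
rewrite in_setT -big_mkcondr /= sum1dep_card.
by congr (_ == _); apply: eq_card => e; rewrite !inE.
Qed.

(** The endpoint [v] gives [e \notin S] from right to left: a matching of [W :\: ends e] cannot
    cover [v]. *)
Lemma induced_matchingU1 W v e S : v \in ends e ->
  induced_matching W (e |: S) && (e \notin S)
  = (ends e \subset W) && induced_matching (W :\: ends e) S.
Proof.
move=> ve; apply/andP/andP => [[/forallP WS eS]|[/subsetP eW /forallP WS]].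
  split.
    apply/subsetP => u ue; have := WS u.
    by rewrite big_setU1 //= ue; case: (u \in W).
  apply/forallP => u; have := WS u; rewrite big_setU1 //= inE.
  by case: (u \in ends e) => /=; case: (u \in W).
have eS : e \notin S.
  apply/negP => eS; have := WS v.
  by rewrite (bigD1 e) //= inE ve.
split=> //; apply/forallP => u; rewrite big_setU1 //= (eqP (WS u)) inE.
by have := eW u; case: (u \in ends e) => //= ->.
Qed.

(** Every matching of [W] has exactly one edge [e] at [v], and removing [e] leaves a matching of
    [W :\: ends e]. *)
Lemma induced_sum_expand W v : v \in W ->
  induced_sum W = \sum_(e | (v \in ends e) && (ends e \subset W))
                    weight e * induced_sum (W :\: ends e).
Proof.
move=> vW.
(* The inner sum has a single term; it is inserted so that the sums over [S] and [e] can be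
   exchanged. *)
transitivity (\sum_(S | induced_matching W S) \sum_(e in S | v \in ends e)
                \prod_(e in S) weight e).
  apply: eq_bigr => S /forallP/(_ v); rewrite vW -big_mkcondr sum1dep_card.
  rewrite sumr_const => /eqP S1; rewrite -[LHS]mulr1n; congr (_ *+ _).
  by rewrite -[1%N]/(nat_of_bool true) -S1; apply: eq_card => e; rewrite !inE.
rewrite (exchange_big_dep (fun e => v \in ends e)) /=; last first.
  by move=> S e _ /andP[].
rewrite big_mkcondr; apply: eq_bigr => e ve.
rewrite (reindex_onto (fun S => e |: S) (fun S => S :\ e)) /=; last first.
  by move=> S /and3P[_ eS _]; rewrite setD1K.
rewrite (eq_bigl (fun S => (ends e \subset W) &&
                           induced_matching (W :\: ends e) S)); last first.
  move=> S; rewrite -(induced_matchingU1 _ _ ve) setU11 ve /= andbT.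
  congr andb; apply/eqP/idP => [<-|eS]; first by rewrite !inE eqxx.
  by rewrite setU1K.
case: ifP => eW; last by rewrite big_pred0.
rewrite /induced_sum big_distrr /=; apply: eq_bigr => S WS.
have /andP[_ eS] : induced_matching W (e |: S) && (e \notin S).
  by rewrite (induced_matchingU1 _ _ ve) eW.
by rewrite big_setU1.
Qed.

Lemma induced_sum0 : (forall e : edge G, ends e != set0) ->
  induced_sum set0 = 1.
Proof.
move=> ne0; rewrite /induced_sum (big_pred1 set0) ?big_set0 // => S.
apply/forallP/eqP => [S0|-> v]; last by rewrite big_set0 inE.
apply/setP => e; rewrite inE; apply/negP => eS.
have /set0Pn[v ve] := ne0 e.
by have := S0 v; rewrite (bigD1 e) //= ve inE.
Qed.

End InducedMatchings.

(** * Matching sums of the [2 x m] grid *)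

Section Grid.
Variables (R : comNzRingType) (a b : R).

Definition hweight (j : nat) : R := if odd j.+1 then b else a.

(** The matching sum of [k] columns; [hweight k2] belongs to the two edges joining the last two of
    [k2 + 2] columns. *)
Fixpoint grid_sum (k : nat) : R :=
  if k is k1.+1 then
    if k1 is k2.+1 then grid_sum k1 + hweight k2 ^+ 2 * grid_sum k2 else 1
  else 1.

Lemma grid_sumSS k :
  grid_sum k.+2 = grid_sum k.+1 + hweight k ^+ 2 * grid_sum k.
Proof. by []. Qed.

Definition first_columns (m k : nat) : {set vertex (grid a b m)} :=
  [set v : 'I_2 * 'I_m | (v.2 < k)%N].

Lemma grid_succ_lt m (j : 'I_m.-1) : (j.+1 < m)%N.
Proof. by have := ltn_ord j; lia. Qed.

Lemma grid_ends_neq0 m (e : edge (grid a b m)) : ends e != set0.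
Proof.
apply/set0Pn; case: e => [j|[i j]]; first by exists (ord0, j); rewrite inE.
by exists (i, Ordinal (grid_succ_lt j)); rewrite inE /= !eqxx orbT.
Qed.

Lemma vertical_subset m k (j : 'I_m) :
  (@ends _ (grid a b m) (inl j) \subset first_columns m k) = (j < k)%N.
Proof.
apply/subsetP/idP => [/(_ (ord0, j))|jk v]; rewrite !inE //=.
  by apply.
by move/eqP->.
Qed.

Lemma horizontal_subset m k (i : 'I_2) (j : 'I_m.-1) :
  (@ends _ (grid a b m) (inr (i, j)) \subset first_columns m k) = (j.+1 < k)%N.
Proof.
apply/subsetP/idP => [/(_ (i, Ordinal (grid_succ_lt j)))|jk v]; rewrite !inE /=.
  by rewrite !eqxx orbT; apply.
by case/andP=> _ /orP[] /eqP ->; lia.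
Qed.

Lemma induced_sum_columnsSS m k : (k.+1 < m)%N ->
  induced_sum (first_columns m k.+2) = induced_sum (first_columns m k.+1)
     + hweight k ^+ 2 * induced_sum (first_columns m k).
Proof.
move=> k1m; have km : (k < m.-1)%N by lia.
pose c := Ordinal k1m; pose j := Ordinal km.
pose h i : edge (grid a b m) := inr (i, j).
pose v i : vertex (grid a b m) := (i, c).
(* The bound on [q] excludes the edge to the right of column [c], so [h i] is the only horizontal
   edge left at [v i]. *)
have hE (i l : 'I_2) (q : 'I_m.-1) :
    (v i \in @ends _ (grid a b m) (inr (l, q))) && (q.+1 < k.+2)%N
    = ((inr (l, q) : edge (grid a b m)) == h i).
  rewrite inE /= /h; apply/idP/eqP => [/andP[/andP[/eqP <- qk] qk2]|[-> ->]].
    by congr (inr (_, _)); apply/val_inj => /=; move/orP: qk => [] /eqP; lia.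
  by rewrite /= !eqxx orbT ltnSn.
rewrite (induced_sum_expand (v := v ord0)); last by rewrite inE /=.
rewrite (bigD1 (inl c : edge (grid a b m))) /=; last first.
  by rewrite vertical_subset inE /= eqxx ltnSn.
rewrite mul1r; congr (induced_sum _ + _).
  by apply/setP => u; rewrite !inE -val_eqE /=; lia.
rewrite (big_pred1 (h ord0)); last first.
  case=> [q|[l q]] /=; last by rewrite horizontal_subset hE andbT.
  by rewrite inE /= -[RHS]/false (inj_eq inl_inj) eq_sym; case: eqP; rewrite ?andbF.
rewrite expr2 -mulrA; congr (_ * _).
rewrite (induced_sum_expand (v := v ord_max)); last first.
  by rewrite !inE /= ltnSn.
rewrite (big_pred1 (h ord_max)) => [|[q|[l q]]] /=.
- congr (_ * induced_sum _); apply/setP => -[u w]; rewrite !inE /=.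
  case: u => -[|[|//]] ? /=; lia.
- apply/negP => /andP[]; rewrite inE /= => /eqP <- /subsetP/(_ (v ord0)).
  by rewrite !inE /= !eqxx orbT => /(_ isT).
- rewrite subsetD horizontal_subset andbA hE; apply/andb_idr => /eqP[-> ->].
  rewrite disjoint_subset; apply/subsetP => u; rewrite !inE.
  by case/andP=> /eqP ->.
Qed.

Lemma induced_sum_columns m k : (k <= m)%N ->
  induced_sum (first_columns m k) = grid_sum k.
Proof.
have sum0 : induced_sum (first_columns m 0) = 1.
  exact: induced_sum0 (@grid_ends_neq0 m).
suff: ((k <= m)%N -> induced_sum (first_columns m k) = grid_sum k) /\
      ((k.+1 <= m)%N -> induced_sum (first_columns m k.+1) = grid_sum k.+1).
  by case.
elim: k => [|k [IH0 IH1]]; last first.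
  split=> // km; rewrite induced_sum_columnsSS // IH1 ?IH0 //; lia.
split=> // m0; pose c := Ordinal m0.
rewrite (induced_sum_expand (v := (ord0, c) : vertex (grid a b m))) ?inE //.
rewrite (big_pred1 (inl c)) => [|[q|[l q]]] /=.
- rewrite mul1r -[RHS]sum0; congr induced_sum.
  by apply/setP => u; rewrite !inE -val_eqE /=; lia.
- by rewrite vertical_subset inE /= (inj_eq inl_inj) -!val_eqE /=; lia.
- by rewrite horizontal_subset ltnS ltn0 andbF.
Qed.

Lemma matching_sum_grid m : matching_sum (grid a b m) = grid_sum m.
Proof.
rewrite matching_sumE -(induced_sum_columns (leqnn m)); congr induced_sum.
by apply/setP => u; rewrite !inE ltn_ord.
Qed.

(** Two steps of the recurrence use one weight of each kind, so eliminating the odd-indexed sums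
    leaves coefficients free of [k]. *)
Lemma grid_sum_evenSS k :
  grid_sum k.+2.*2
  = (1 + a ^+ 2 + b ^+ 2) * grid_sum k.+1.*2 - a ^+ 2 * b ^+ 2 * grid_sum k.*2.
Proof.
rewrite !doubleS !grid_sumSS /hweight /= odd_double /=; ring.
Qed.

Lemma grid_sum_even_det k :
  grid_sum k.+2.*2 * grid_sum k.*2 = grid_sum k.+1.*2 ^+ 2 + (a ^+ k.+1 * b ^+ k) ^+ 2.
Proof.
elim: k => [|k IHk]; first by rewrite /= /hweight /=; ring.
have -> : (a ^+ k.+2 * b ^+ k.+1) ^+ 2 = a ^+ 2 * b ^+ 2 * (a ^+ k.+1 * b ^+ k) ^+ 2.
  by rewrite !exprS; ring.
(* The induction hypothesis eliminates the monomial; the recurrence then leaves a polynomial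
   identity in [E0] and [E1]. *)
have -> : (a ^+ k.+1 * b ^+ k) ^+ 2
    = grid_sum k.+2.*2 * grid_sum k.*2 - grid_sum k.+1.*2 ^+ 2.
  by rewrite IHk; ring.
rewrite (grid_sum_evenSS k.+1); have := grid_sum_evenSS k.
set E0 := grid_sum k.*2; set E1 := grid_sum k.+1.*2; set E2 := grid_sum k.+2.*2.
by move=> ->; ring.
Qed.

End Grid.

(** * Passage to the cluster sequence *)

Lemma rmorph_grid_sum (R S : comNzRingType) (f : {rmorphism R -> S}) (a b : R) k :
  f (grid_sum a b k) = grid_sum (f a) (f b) k.
Proof.
suff [] : f (grid_sum a b k) = grid_sum (f a) (f b) k /\
          f (grid_sum a b k.+1) = grid_sum (f a) (f b) k.+1 by [].
elim: k => [|k [IH0 IH1]]; first by rewrite /= rmorph1.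
split=> //; rewrite !grid_sumSS rmorphD rmorphM rmorphXn /= IH0 IH1.
by rewrite /hweight; case: ifP.
Qed.

Lemma grid_sum00 (R : comNzRingType) k : grid_sum (0 : R) 0 k = 1.
Proof.
suff [] : grid_sum (0 : R) 0 k = 1 /\ grid_sum (0 : R) 0 k.+1 = 1 by [].
elim: k => [|k [IH0 IH1]] //; split=> //.
by rewrite grid_sumSS /hweight if_same expr0n mul0r addr0.
Qed.

(** Indexing by [nat] lets this serve both halves of the cluster sequence, upwards from index 1 and
    downwards from index 2. *)
Lemma rec_seq_grid_sum (K : fieldType) (a b : K) (x : nat -> K) :
    a != 0 -> b != 0 -> (forall k, grid_sum a b k.*2 != 0) ->
    x 0%N = a -> x 1%N = b ->
    (forall k, x k.+2 * x k = x k.+1 ^+ 2 + 1) ->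
  forall k, x k.+2 = grid_sum a b k.+1.*2 / (a ^+ k.+1 * b ^+ k).
Proof.
move=> a0 b0 E0 x0 x1 xr.
have x2 : x 2 = grid_sum a b 2 / (a ^+ 1 * b ^+ 0).
  apply: (mulIf a0); rewrite -{1}x0 xr x1 /= /hweight /=; by field.
have x3 : x 3 = grid_sum a b 4 / (a ^+ 2 * b ^+ 1).
  apply: (mulIf b0); rewrite -{1}x1 xr x2 /= /hweight /=; by field; rewrite a0 b0.
suff P k : x k.+2 = grid_sum a b k.+1.*2 / (a ^+ k.+1 * b ^+ k) /\
           x k.+3 = grid_sum a b k.+2.*2 / (a ^+ k.+2 * b ^+ k.+1).
  by move=> k; case: (P k).
elim: k => [//|k [IH0 IH1]]; split=> //.
have x_n0 : x k.+2 != 0.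
  by rewrite IH0 mulf_neq0 ?invr_eq0 ?mulf_neq0 ?expf_neq0.
apply: (mulIf x_n0); rewrite xr IH0 IH1.
have := grid_sum_even_det a b k.+1.
set F1 := grid_sum a b k.+1.*2; set F2 := grid_sum a b k.+2.*2.
set F3 := grid_sum a b k.+3.*2 => D.
have [ak bk] : a ^+ k != 0 /\ b ^+ k != 0 by rewrite !expf_neq0.
(* The squared denominator of [x k.+3] is also the product of the denominators claimed for [x k.+2]
   and [x k.+4], so [D] applies. *)
transitivity ((F2 ^+ 2 + (a ^+ k.+2 * b ^+ k.+1) ^+ 2) / (a ^+ k.+2 * b ^+ k.+1) ^+ 2).
  by rewrite !exprS; field; rewrite a0 b0 ak bk.
by rewrite -D !exprS; field; rewrite a0 b0 ak bk.
Qed.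

Lemma X_neq0 (i : 'I_2) : to_ratfun 'X_i != 0.
Proof. exact: pos_at_1_neq0 (pos_at_1_X i). Qed.

(* At (0, 0) only the matching by vertical edges survives. *)
Lemma grid_sum_X_neq0 (i j : 'I_2) k :
  grid_sum (to_ratfun 'X_i) (to_ratfun 'X_j) k != 0.
Proof.
rewrite -rmorph_grid_sum tofrac_eq0.
apply/eqP => E0.
have := rmorph_grid_sum (meval (fun=> 0 : rat)) 'X_i 'X_j k.
by rewrite E0 rmorph0 /= !mevalXU grid_sum00 => /eqP; rewrite eq_sym oner_eq0.
Qed.

Unset Implicit Arguments.

Theorem theorem1 (x : int -> ratfun2) (hx : is_cluster_seq x)
    (n : int) (hn1 : n <> 1) (hn2 : n <> 2) :
  x n = to_ratfun (p_ n) / to_ratfun (m_ n).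
Proof.
case: hx => x_1 x_2 xr; rewrite /p_ /G_ /m_; case: ifP => n3.
  have [k nE] : exists k : nat, n = k%:Z + 3 by exists (absz (n - 3)%R); lia.
  have -> : absz (2 * n - 4)%R = k.+1.*2 by lia.
  have -> : absz (n - 2)%R = k.+1 by lia.
  have -> : absz (n - 3)%R = k by lia.
  rewrite matching_sum_grid rmorph_grid_sum rmorphM !rmorphXn /=.
  have -> : n = k.+2%:Z + 1 by lia.
  apply: (rec_seq_grid_sum (x := fun k : nat => x (k%:Z + 1))) => //.
  - exact: X_neq0.
  - exact: X_neq0.
  - by move=> i; apply: grid_sum_X_neq0.
  - move=> i; have := xr (i.+2%:Z + 1).
    have -> : i.+2%:Z + 1 - 2 = i%:Z + 1 by lia.
    by have -> : i.+2%:Z + 1 - 1 = i.+1%:Z + 1 by lia.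
(* For [n <= 0] the sequence is read backwards from [x 2], [x 1]; the recurrence is symmetric in its
   outer terms. *)
have [k nE] : exists k : nat, n = - k%:Z by exists (absz n); lia.
have -> : absz (2 * (3 - n) - 4)%R = k.+1.*2 by lia.
have -> : absz (- n)%R = k by lia.
have -> : absz (1 - n)%R = k.+1 by lia.
rewrite matching_sum_grid rmorph_grid_sum [X1 ^+ _ * _]mulrC rmorphM !rmorphXn /=.
have -> : n = 2 - k.+2%:Z by lia.
apply: (rec_seq_grid_sum (x := fun k : nat => x (2 - k%:Z))) => //.
- exact: X_neq0.
- exact: X_neq0.
- by move=> i; apply: grid_sum_X_neq0.
- move=> i; have := xr (2 - i%:Z).
  have -> : 2 - i%:Z - 2 = 2 - i.+2%:Z by lia.
  have -> : 2 - i%:Z - 1 = 2 - i.+1%:Z by lia.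
  by rewrite mulrC.
Qed.
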